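(* Let $G$ be a graph of order $n$, let $x$ be a vertex of $G$, and let $e=uv$ be an edge of $G$. In the statements below, $Y$ denotes either of the two parameters $\gamma_P$ (power domination) or $\operatorname{Z}_+$ (PSD forcing), and every inequality involving the no initial cost product throttling number $\operatorname{th}^{\ast}$ of $G-e$, $G-x$ or $G/e$ is asserted under the assumption that the graph in question ($G-e$, $G-x$ or $G/e$, respectively) has at least one edge. (1) $\frac12\operatorname{th}_Y^{\ast}(G)\le \operatorname{th}_Y^{\ast}(G-e)\le 2\operatorname{th}_Y^{\ast}(G)$ and $\frac12\operatorname{th}_Y^{\times}(G)\le \operatorname{th}_Y^{\times}(G-e)\le 2\operatorname{th}_Y^{\times}(G)$. (2) $\frac12\operatorname{th}_Y^{\ast}(G)\le \operatorname{th}_Y^{\ast}(G-x)$ and $\frac12\operatorname{th}_Y^{\times}(G)\le \operatorname{th}_Y^{\times}(G-x)$. (3) $\frac12\operatorname{th}_{\gamma_P}^{\ast}(G)\le \operatorname{th}_{\gamma_P}^{\ast}(G/e)\le 2\operatorname{th}_{\gamma_P}^{\ast}(G)$ and $\frac12\operatorname{th}_{\gamma_P}^{\times}(G)\le \operatorname{th}_{\gamma_P}^{\times}(G/e)\le 2\operatorname{th}_{\gamma_P}^{\times}(G)$. (4) $\frac12\operatorname{th}_{+}^{\ast}(G)\le \operatorname{th}_{+}^{\ast}(G/e)$ and $\frac12\operatorname{th}_{+}^{\times}(G)\le \operatorname{th}_{+}^{\times}(G/e)$. (5) $\operatorname{th}_Y^{\ast}(G)\le \operatorname{th}_Y^{\ast}(G_e)\le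 2\operatorname{th}_Y^{\ast}(G)$. (6) $\operatorname{th}_{\gamma_P}^{\times}(G)\le \operatorname{th}_{\gamma_P}^{\times}(G_e)\le 2\operatorname{th}_{\gamma_P}^{\times}(G)$ and $\operatorname{th}_{+}^{\times}(G)\le \operatorname{th}_{+}^{\times}(G_e)\le \frac32\operatorname{th}_{+}^{\times}(G)$.
   Context: All graphs are finite, simple and undirected; the order of a graph is its number of vertices. Graph operations: $G-x$ is obtained from $G$ by deleting the vertex $x$ and all edges incident to $x$; $G-e$ by deleting the edge $e$; the contraction $G/e$ by identifying $u$ and $v$ and suppressing any loops or multiple edges that arise; the subdivision $G_e$ by adding a new vertex $z$, adding the edges $uz$ and $vz$, and removing the edge $e=uv$. Propagation processes: start with a set $B\subseteq V(G)$ of filled vertices, all other vertices being unfilled. In each time step, all vertices that can be filled given the set of vertices filled at the end of the previous step are filled simultaneously. Standard color change rule: if $w$ is the unique unfilled neighbor of a filled vertex $v$, then fill $w$. PSD color change rule (used in every time step for PSD forcing): let $C$ be the set of currently filled vertices and let $W_1,\dots,W_k$ be the vertex sets of the components of $G[V(G)\setminus C]$; if $v\in C$, $w\in W_i$, and $w$ is the only unfilled neighbor of $v$ in $G[W_i\cup C]$, then fill $w$. Power domination: in time step 1 (the domination step) every neighbor of a vertex of $B$ is filled; in all later time steps the standard color change rule is used. Let $B^{[0]}=B$ and let $B^{[i]}$ be the set of vertices filled after time step $i$ of the process for $Y$ ($Y=\gamma_P$ for power domination, $Y=\operatorname{Z}_+$ for PSD forcing). The propagation time $\operatorname{pt}_Y(G,B)$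 is the least $t\ge0$ with $B^{[t]}=V(G)$, and is $\infty$ if no such $t$ exists. Initial cost product throttling number, for a graph $G$ of order $n$: $$\operatorname{th}_Y^{\times}(G)=\min_{1\le k\le n}\ \min_{B\subseteq V(G),\,|B|=k}|B|\bigl(1+\operatorname{pt}_Y(G,B)\bigr).$$ No initial cost product throttling number, for a graph $G$ of order $n$ that has an edge: $$\operatorname{th}_Y^{\ast}(G)=\min_{1\le k\le n-1}\ \min_{B\subseteq V(G),\,|B|=k}|B|\operatorname{pt}_Y(G,B).$$ For $Y=\operatorname{Z}_+$ these are written $\operatorname{th}_+^{\times}$ and $\operatorname{th}_+^{\ast}$. *)

(* Defs.v *)
From mathcomp Require Import all_boot all_order all_algebra.
From mathcomp Require Import boolp constructive_ereal.

Set Implicit Arguments.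
Unset Strict Implicit.
Unset Printing Implicit Defensive.

Import Order.TTheory GRing.Theory Num.Theory.

Record sgraph := SGraph {
  vertex :> finType;
  adj : rel vertex;
  adj_sym : symmetric adj;
  adj_irrefl : irreflexive adj }.

Definition has_edge (G : sgraph) : Prop := exists a b : G, adj a b.

Section Operations.
Variable G : sgraph.

Section DeleteVertex.
Variable x : G.

Definition delv_rel : rel {y : G | y != x} := fun a b => adj (val a) (val b).

Fact delv_sym : symmetric delv_rel.
Proof. by move=> a b; rewrite /delv_rel adj_sym. Qed.

Fact delv_irrefl : irreflexive delv_rel.
Proof. by move=> a; rewrite /delv_rel adj_irrefl. Qed.

Definition delete_vertex : sgraph := SGraph delv_sym delv_irrefl.
End DeleteVertex.

Section EdgeOperations.
Variables u v : G.

Definition dele_rel : rel G :=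
  fun a b => adj a b && ([set a; b] != [set u; v]).

Fact dele_sym : symmetric dele_rel.
Proof. by move=> a b; rewrite /dele_rel adj_sym setUC. Qed.

Fact dele_irrefl : irreflexive dele_rel.
Proof. by move=> a; rewrite /dele_rel adj_irrefl. Qed.

Definition delete_edge : sgraph := SGraph dele_sym dele_irrefl.

(* The vertex obtained by identifying [u] and [v] is named [u], so
   that [merge] is the quotient map onto the vertices other than [v]. *)
Definition merge (a : G) : G := if a == v then u else a.

Definition contract_rel : rel {y : G | y != v} := fun a b =>
  (a != b) &&
  [exists a' : G, exists b' : G,
    [&& merge a' == val a, merge b' == val b & adj a' b']].

Fact contract_sym : symmetric contract_rel.
Proof.
suff H a b : contract_rel a b -> contract_rel b a.
  by move=> a b; apply/idP/idP; apply: H.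
case/andP=> ab /existsP[a' /existsP[b' /and3P[aa bb e]]].
rewrite /contract_rel eq_sym ab; apply/existsP; exists b'.
by apply/existsP; exists a'; rewrite aa bb adj_sym.
Qed.

Fact contract_irrefl : irreflexive contract_rel.
Proof. by move=> a; rewrite /contract_rel eqxx. Qed.

Definition contract_edge : sgraph := SGraph contract_sym contract_irrefl.

(* The new vertex is [None]. *)
Definition subdivide_rel : rel (option G) := fun a b =>
  match a, b with
  | Some a', Some b' => dele_rel a' b'
  | Some a', None => a' \in [set u; v]
  | None, Some b' => b' \in [set u; v]
  | None, None => false
  end.

Fact subdivide_sym : symmetric subdivide_rel.
Proof. by case=> [a|] [b|] //=; apply: dele_sym. Qed.

Fact subdivide_irrefl : irreflexive subdivide_rel.
Proof. by case=> [a|] //=; apply: dele_irrefl. Qed.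

Definition subdivide_edge : sgraph := SGraph subdivide_sym subdivide_irrefl.
End EdgeOperations.
End Operations.

Inductive process := PowerDomination | PSDForcing.

Section Propagation.
Variable G : sgraph.
Implicit Types (A B C W : {set G}) (v w : G).

Definition domination_step C : {set G} :=
  C :|: [set w | [exists v in C, adj v w]].

Definition standard_step C : {set G} :=
  C :|: [set w | [exists v in C, [set y in ~: C | adj v y] == [set w]]].

(* The vertex sets of the components of the induced subgraph [G[A]]. *)
Definition components A : {set {set G}} :=
  equivalence_partition
    (connect (fun a b : G => [&& a \in A, b \in A & adj a b])) A.

Definition psd_step C : {set G} :=
  C :|: [set w | [exists W in components (~: C), exists v in C,
    (w \in W) && ([set y in W :|: C | adj v y & y \notin C] == [set w])]].

Fixpoint filled (Y : process) B (i : nat) : {set G} :=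
  match i with
  | 0 => B
  | j.+1 =>
    match Y with
    | PowerDomination =>
      if j == 0 then domination_step (filled Y B j)
      else standard_step (filled Y B j)
    | PSDForcing => psd_step (filled Y B j)
    end
  end.

Local Open Scope ereal_scope.

Definition pt (Y : process) B : \bar rat :=
  if pselect (exists t, filled Y B t == [set: G]) is left ex_t
  then (ex_minn ex_t)%:R%:E else +oo.

(* Minima are taken in [\bar rat] so that infinite propagation times and the
   factors 1/2 and 3/2 can be used directly. *)
Definition th_times (Y : process) : \bar rat :=
  \big[mine/+oo]_(1 <= k < #|G|.+1)
    \big[mine/+oo]_(B : {set G} | #|B| == k) (#|B|%:R%:E * (1 + pt Y B)).

(* [th_star Y = +oo] if [G] has no edge. *)
Definition th_star (Y : process) : \bar rat :=
  \big[mine/+oo]_(1 <= k < #|G|)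
    \big[mine/+oo]_(B : {set G} | #|B| == k) (#|B|%:R%:E * pt Y B).

End Propagation.

(* Main.v *)
(** Each inequality follows from turning a set [B] that fills one graph in [t]
    steps into a set [B'] that fills the other graph in [t] steps with
    [#|B'| <= #|B| + d], where [d <= 1]: since [0 < #|B|], this costs at most a
    factor [d + 1].  In th*, if [B'] is too large to be admissible, then the
    complement of a non-isolated vertex, which has propagation time 1, does at
    least as well.  To compare the two processes one exhibits an increasing
    family [S i] of sets in the second graph, built from the sets filled in the
    first, such that each vertex of [S i.+1] outside [S i] is forced by [S i];
    monotonicity of the color change rules puts [S i] among the vertices filled
    after [i] steps.  For PSD forcing and the subdivision, [B' = B] works with
    [t + 1] steps, and [2 (t + 2) <= 3 (t + 1)] for [0 < t] gives the factor
    3/2; the case [t = 0] uses all vertices. *)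

Require Import Defs.
From mathcomp Require Import all_boot all_order all_algebra.
From mathcomp Require Import boolp constructive_ereal.

Set Implicit Arguments.
Unset Strict Implicit.
Unset Printing Implicit Defensive.

Import Order.TTheory GRing.Theory Num.Theory.

(** * Propagation as a single forcing rule *)

Definition unfilled_adj (G : sgraph) (C : {set G}) : rel G :=
  fun a b => [&& a \notin C, b \notin C & adj a b].

(* All three rules have the form "[x] forces [w] if no other unfilled neighbor
   of [x] is a rival of [w]": nothing is a rival in the domination step,
   everything in the standard rule, the component of [w] in PSD forcing. *)
Definition rivals (Y : process) (i : nat) (G : sgraph) (C : {set G}) : rel G :=
  match Y with
  | PowerDomination => fun _ _ => i != 0
  | PSDForcing => connect (unfilled_adj C)
  end.

Definition forces Y i (G : sgraph) (C : {set G}) (x w : G) : Prop :=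
  [/\ x \in C, adj x w &
      forall y, y \notin C -> adj x y -> rivals Y i C y w -> y = w].

Lemma unfilled_connect_sym (G : sgraph) (C : {set G}) :
  connect_sym (unfilled_adj C).
Proof.
by apply: sym_connect_sym => a b; rewrite /unfilled_adj adj_sym andbCA.
Qed.

Lemma rivals_sym Y i (G : sgraph) (C : {set G}) : symmetric (rivals Y i C).
Proof. by case: Y => //; apply: unfilled_connect_sym. Qed.

Lemma rivals_adjl Y i (G : sgraph) (C : {set G}) (a b w : G) :
  a \notin C -> b \notin C -> adj a b -> rivals Y i C a w -> rivals Y i C b w.
Proof.
case: Y => //= aC bC ab; apply: connect_trans; apply: connect1.
by rewrite /unfilled_adj aC bC adj_sym ab.
Qed.

(** Only PSD forcing has content: components go into components. The hypothesis asks for a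
    connection rather than an edge, so that [f] may contract an edge or replace it by a path. *)
Lemma rivals_map Y i (G H : sgraph) (f : G -> H) (C : {set G}) (D : {set H})
    (a b : G) :
  (forall c d, c \notin C -> d \notin C -> adj c d ->
     connect (unfilled_adj D) (f c) (f d)) ->
  rivals Y i C a b -> rivals Y i D (f a) (f b).
Proof.
case: Y => //= fE /connectP[p cp ->].
elim: p a cp => [|c p IHp] a //= /andP[/and3P[aC cC ac] cp].
exact: connect_trans (fE _ _ aC cC ac) (IHp _ cp).
Qed.

Lemma psd_stepP (G : sgraph) (C : {set G}) (w : G) i :
  w \in psd_step C <-> w \in C \/ exists x, forces PSDForcing i C x w.
Proof.
have eqe : (fun a b : G => [&& a \in ~: C, b \in ~: C & adj a b])
    =2 unfilled_adj C by move=> a b; rewrite !inE.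
rewrite in_setU inE; split=> [/orP[|]|]; first by left.
  case/exists_inP=> W /imsetP[z zC ->] /exists_inP[x xC].
  rewrite !inE (eq_connect eqe) => /andP[/andP[wC zw] /eqP xE].
  right; exists x.
  have mE y : (y \in [set w]) = [&& (y \notin C) && connect (unfilled_adj C) z y
      || (y \in C), adj x y & y \notin C].
    by rewrite -xE !inE (eq_connect eqe).
  split=> //; first by move: (mE w); rewrite set11 => /esym/and3P[].
  move=> y yC xy yw; apply/set1P; rewrite mE yC xy /= andbT.
  by rewrite (connect_trans zw) // unfilled_connect_sym.
case=> [-> //|[x [xC xw xP]]]; have [//|wC] := boolP (w \in C).
apply/exists_inP; exists [set y in ~: C | connect (unfilled_adj C) w y].
  apply/imsetP; exists w; first by rewrite inE.
  by apply/setP => y; rewrite !inE (eq_connect eqe).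
apply/exists_inP; exists x => //; rewrite !inE wC connect0 /=.
apply/eqP/setP => y; rewrite !inE; apply/idP/eqP => [|->]; last first.
  by rewrite wC connect0 xw.
case/and3P=> yP xy yC; apply: xP => //.
by move: yP; rewrite (negbTE yC) /= orbF unfilled_connect_sym.
Qed.

Lemma standard_stepP (G : sgraph) (C : {set G}) (w : G) i :
  w \in standard_step C <->
  w \in C \/ exists x, forces PowerDomination i.+1 C x w.
Proof.
rewrite in_setU inE; split=> [/orP[|]|]; first by left.
  case/exists_inP=> x xC /eqP xE; right; exists x.
  have mE y : (y \in [set w]) = (y \notin C) && adj x y by rewrite -xE !inE.
  split=> //; first by move: (mE w); rewrite set11 => /esym/andP[].
  by move=> y yC xy _; apply/set1P; rewrite mE yC xy.
case=> [-> //|[x [xC xw xP]]]; have [//|wC] := boolP (w \in C).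
apply/exists_inP; exists x => //; apply/eqP/setP => y; rewrite !inE.
by apply/andP/eqP => [[yC xy]|->]; [apply: xP|split].
Qed.

Lemma filledSP Y (G : sgraph) (B : {set G}) i (w : G) :
  w \in filled Y B i.+1 <->
  w \in filled Y B i \/ exists x, forces Y i (filled Y B i) x w.
Proof.
case: Y => /=; last exact: psd_stepP.
case: i => [|i] /=; last exact: standard_stepP.
rewrite in_setU inE; split=> [/orP[|/exists_inP[x xB xw]]|].
- by left.
- by right; exists x.
- case=> [-> //|[x [xB xw _]]]; apply/orP; right.
  by apply/exists_inP; exists x.
Qed.

(** Enlarging the filled set removes unfilled neighbors and can only split components, so no new
    rivals appear. *)
Lemma forces_mono Y i (G : sgraph) (C D : {set G}) (x w : G) :
  C \subset D -> forces Y i C x w -> forces Y i D x w.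
Proof.
move=> sCD [xC xw xP]; split=> // [|y yD xy yw]; first exact: (subsetP sCD).
have nC z : z \notin D -> z \notin C by apply: contra; apply: (subsetP sCD).
apply: xP xy _ => //; first exact: nC.
apply: (@rivals_map Y i G G id) yw => a b aD bD ab.
by apply: connect1; rewrite /unfilled_adj !nC.
Qed.

Lemma filled_mono Y (G : sgraph) (B : {set G}) i j :
  i <= j -> filled Y B i \subset filled Y B j.
Proof.
elim: j => [|j IHj]; first by rewrite leqn0 => /eqP->.
rewrite leq_eqVlt => /predU1P[-> //|/IHj/subsetP sij].
by apply/subsetP => w /sij wj; apply/filledSP; left.
Qed.

Lemma filled_chain Y (G : sgraph) (B : {set G}) (S : nat -> {set G}) :
  S 0 \subset B ->
  (forall i w, w \in S i.+1 -> w \notin S i ->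
     exists x, forces Y i (S i) x w) ->
  forall i, S i \subset filled Y B i.
Proof.
move=> S0 SP; elim=> [//|i IHi]; apply/subsetP => w wS; apply/filledSP.
have [wi|wi] := boolP (w \in S i); first by left; apply: (subsetP IHi).
by have [x xw] := SP i w wS wi; right; exists x; apply: forces_mono xw.
Qed.

Lemma filled_all Y (G : sgraph) (B : {set G}) (S : nat -> {set G}) t :
  (forall w, w \in S t) -> S 0 \subset B ->
  (forall i w, w \in S i.+1 -> w \notin S i ->
     exists x, forces Y i (S i) x w) ->
  filled Y B t = [set: G].
Proof.
move=> St S0 SP; apply/setP => w; rewrite in_setT.
exact: (subsetP (filled_chain S0 SP t)).
Qed.

(** The filled sets increase, so one of two vertices is never filled after the other. Renaming them
    [p] (earlier) and [q] (later) orients an edge once and for all. *)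
Lemma filled_total Y (G : sgraph) (B : {set G}) (u v : G) :
  exists p q, [/\ [set p; q] = [set u; v], p \in [set u; v], q \in [set u; v] &
    forall i, q \in filled Y B i -> p \in filled Y B i].
Proof.
have [vu|/existsNP[i /not_implyP[vi /negP ui]]] :=
  pselect (forall i, v \in filled Y B i -> u \in filled Y B i).
  by exists u, v; split; rewrite ?set21 ?set22.
exists v, u; split; rewrite ?set21 ?set22 1?setUC // => j uj.
have [ij|ji] := leqP i j; first exact: (subsetP (filled_mono Y B ij)).
by rewrite (subsetP (filled_mono Y B (ltnW ji)) _ uj) in ui.
Qed.

(** [k.+1] is the time step in which [z] is filled, and [x] is a vertex that forces it then. *)
Lemma filled_first Y (G : sgraph) (B : {set G}) (z : G) t :
  z \in filled Y B t -> z \notin B ->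
  exists k x, [/\ z \notin filled Y B k, forces Y k (filled Y B k) x z &
    forall i, (z \in filled Y B i) = (k < i)].
Proof.
move=> zt zB; have ex_t : exists t, z \in filled Y B t by exists t.
case: (ex_minnP ex_t) => -[|k] zk kP; first by rewrite zk in zB.
have nzk : z \notin filled Y B k.
  by apply/negP => /kP; rewrite ltnn.
case/filledSP: (zk) => [zk'|[x xz]]; first by rewrite zk' in nzk.
exists k, x; split=> // i; apply/idP/idP => [/kP //|ki].
exact: (subsetP (filled_mono Y B ki)).
Qed.

Lemma eq_set2 (T : finType) (a b p q : T) :
  [set a; b] = [set p; q] -> (a = p /\ b = q) \/ (a = q /\ b = p).
Proof.
move=> eqS; have := set21 a b; have := set22 a b; rewrite eqS !inE.
have := set21 p q; have := set22 p q; rewrite -eqS !inE.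
by do 4!case/orP=> /eqP ?; subst; auto.
Qed.

Definition transfers Y (G H : sgraph) (d : nat) : Prop :=
  forall (B : {set G}) t, 0 < #|B| -> filled Y B t = [set: G] ->
  exists B' : {set H},
    [/\ 0 < #|B'|, #|B'| <= #|B| + d & filled Y B' t = [set: H]].

(** * Deletion of an edge or a vertex *)

(* Adding the later-filled endpoint of [e] to [B] ensures that [e] is never
   used for a force and never provides an unfilled neighbor. *)
Lemma transfer_delete_edge Y (G : sgraph) (u v : G) :
  transfers Y G (delete_edge u v) 1.
Proof.
move=> B t B0 Bt; have [p [q [pq _ _ qp]]] := filled_total Y B u v.
pose S i : {set G} := q |: filled Y B i.
have SE i w : (w \in S i) = (w == q) || (w \in filled Y B i).
  by rewrite in_setU1.
have subS i y : y \notin S i -> y \notin filled Y B i.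
  by rewrite SE negb_or => /andP[].
exists (S 0); split.
- by apply/card_gt0P; exists q; rewrite SE eqxx.
- by rewrite addn1 cardsU1; case: (_ \notin _).
apply: (@filled_all Y (delete_edge u v) (S 0) S) => // [w|i w wS1 wS].
  by rewrite SE Bt in_setT orbT.
move: wS1 (wS); rewrite !SE negb_or => wS1 /andP[wq wC].
move: wS1; rewrite (negbTE wq) => /filledSP[wC'|[x [xC xw xP]]].
  by rewrite wC' in wC.
exists x; split; first by rewrite SE xC orbT.
  rewrite /= /dele_rel xw /=; apply/eqP.
  rewrite -pq => /eq_set2[[_ wE]|[xE wE]].
    by rewrite wE eqxx in wq.
  by subst x w; rewrite qp in wC.
move=> y yS /andP[xy _] yw; apply: xP (subS _ _ yS) xy _.
apply: (@rivals_map Y i (delete_edge u v) G id (S i)) yw => a b aS bS.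
case/andP=> ab _.
by apply: connect1; rewrite /unfilled_adj !subS.
Qed.

(** With the later-filled endpoint [q] in the set, the restored edge joins no two unfilled vertices.
    It could only disturb a force by [q] while [p] is unfilled, but forces are copied from the
    original process, where [q] does not precede [p]. *)
Lemma transfer_undelete_edge Y (G : sgraph) (u v : G) :
  transfers Y (delete_edge u v) G 1.
Proof.
move=> B t B0 Bt; have [p [q [pq _ _ qp]]] := filled_total Y B u v.
pose S i : {set G} := q |: filled Y B i.
have SE i w : (w \in S i) = (w == q) || (w \in filled Y B i).
  by rewrite in_setU1.
have subS i y : y \notin S i -> y != q /\ y \notin filled Y B i.
  by rewrite SE negb_or => /andP[].
exists (S 0); split.
- by apply/card_gt0P; exists q; rewrite SE eqxx.
- by rewrite addn1 cardsU1; case: (_ \notin _).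
apply: (@filled_all Y G (S 0) S) => // [w|i w wS1 wS].
  by rewrite SE Bt in_setT orbT.
move: wS1 (wS); rewrite !SE negb_or => wS1 /andP[wq wC].
move: wS1; rewrite (negbTE wq) => /filledSP[wC'|[x [xC xw xP]]].
  by rewrite wC' in wC.
exists x; split; first by rewrite SE xC orbT.
  by case/andP: xw.
move=> y yS xy yw; have [yq yC] := subS _ _ yS; apply: xP => //.
  rewrite /= /dele_rel xy /=; apply/eqP.
  rewrite -pq => /eq_set2[[_ yE]|[xE yE]].
    by rewrite yE eqxx in yq.
  by subst x y; rewrite qp in yC.
apply: (@rivals_map Y i G (delete_edge u v) id (S i)) yw => a b.
case/subS=> aq aC /subS[bq bC] ab; apply: connect1.
rewrite /unfilled_adj aC bC /= /dele_rel ab /=; apply/eqP; rewrite -pq.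
by case/eq_set2=> -[aE bE]; [rewrite bE eqxx in bq|rewrite aE eqxx in aq].
Qed.

(** Filled from the start, [x] is never an unfilled neighbor and lies on no unfilled path, so all
    forces carry over. *)
Lemma transfer_delete_vertex Y (G : sgraph) (x : G) :
  transfers Y (delete_vertex x) G 1.
Proof.
move=> B t B0 Bt.
pose S i : {set G} := x |: [set val a | a in filled Y B i].
have SE i (a : delete_vertex x) : (val a \in S i) = (a \in filled Y B i).
  by rewrite in_setU1 (negbTE (valP a)) /= mem_imset //; apply: val_inj.
have S_other i w : w \notin S i -> exists a : delete_vertex x, w = val a.
  rewrite in_setU1 negb_or => /andP[wx _].
  by exists (Sub w wx); rewrite SubK.
have xS i : x \in S i by rewrite setU11.
exists (S 0); split.
- by apply/card_gt0P; exists x.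
- rewrite addn1 cardsU1 card_imset; last exact: val_inj.
  by case: (_ \notin _).
apply: (@filled_all Y G (S 0) S) => // [w|i w wS1 wS].
  apply/negPn/negP => wS; have [a wE] := S_other _ _ wS.
  by rewrite wE SE Bt in_setT in wS.
have [a wE] := S_other _ _ wS; subst w; move: wS1 wS; rewrite !SE.
case/filledSP=> [-> //|[b [bC ba bP]]] aC.
exists (val b); split=> //; first by rewrite SE.
move=> y yS byE; have [c yE] := S_other _ _ yS; subst y.
rewrite SE in yS => ca; congr (val _); apply: bP => //.
(* A left inverse of [val]; the default [b] is taken at [x] only, which is never unfilled. *)
pose f y : delete_vertex x := insubd b y.
have fK c' : f (val c') = c' by apply: valKd.
rewrite -[c]fK -[a]fK; apply: (@rivals_map Y i _ _ f (S i)) ca => d1 d2 d1S d2S.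
have [c1 E1] := S_other _ _ d1S; have [c2 E2] := S_other _ _ d2S; subst d1 d2.
rewrite !fK => c12; apply: connect1.
by rewrite /unfilled_adj -!SE d1S d2S.
Qed.

(** * Contraction *)

Section Contract.
Variables (G : sgraph) (u v : G) (e : adj u v).

Lemma contract_vertex_neq : u != v.
Proof. by apply/eqP => uv; move: e; rewrite uv adj_irrefl. Qed.

Definition merged : contract_edge u v := Sub u contract_vertex_neq.

(** The quotient map; the default of [insubd] is never taken, as [merge] avoids [v]. *)
Definition contract_map (a : G) : contract_edge u v :=
  insubd merged (Defs.merge u v a).

Lemma contract_mapE a : val (contract_map a) = Defs.merge u v a.
Proof.
rewrite /contract_map insubdK // /Defs.merge unfold_in /=.
by case: ifP => [_|/negbT //]; apply: contract_vertex_neq.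
Qed.

Lemma contract_mapK (A : contract_edge u v) : contract_map (val A) = A.
Proof.
by apply: val_inj; rewrite contract_mapE /Defs.merge (negbTE (valP A)).
Qed.

Lemma contract_mergedP a : (contract_map a == merged) = (a \in [set u; v]).
Proof.
rewrite -val_eqE /= contract_mapE /Defs.merge !inE.
by have [->|_] := eqVneq a v; rewrite ?eqxx ?orbT ?orbF.
Qed.

Lemma contract_map_inj a b :
  contract_map a != merged -> contract_map a = contract_map b -> a = b.
Proof.
move=> am ab; have bm : contract_map b != merged by rewrite -ab.
move/(congr1 val): ab; rewrite !contract_mapE /Defs.merge.
move: am bm; rewrite !contract_mergedP !inE !negb_or.
by move=> /andP[_ /negbTE->] /andP[_ /negbTE->].
Qed.

Lemma contract_adjP (A B : contract_edge u v) :
  reflect (A <> B /\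
           exists a b, [/\ contract_map a = A, contract_map b = B & adj a b])
    (adj A B).
Proof.
rewrite /= /contract_rel; apply: (iffP andP).
  case=> /eqP AB /existsP[a /existsP[b /and3P[/eqP aA /eqP bB ab]]].
  by split=> //; exists a, b; split=> //; apply: val_inj; rewrite contract_mapE.
case=> /eqP AB [a [b [aA bB ab]]]; split=> //.
apply/existsP; exists a; apply/existsP; exists b.
by rewrite -aA -bB !contract_mapE !eqxx.
Qed.

Lemma contract_adj a b : adj a b ->
  contract_map a = contract_map b \/ adj (contract_map a) (contract_map b).
Proof.
move=> ab; have [->|/eqP nab] := eqVneq (contract_map a) (contract_map b).
  by left.
by right; apply/contract_adjP; split=> //; exists a, b.
Qed.

(* If the merged vertex is forced, its forcer is adjacent to one endpoint [q]
   of [e]; the other endpoint [p] is added to [B], and the same vertex then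
   forces [q]. *)
Lemma transfer_uncontract Y : transfers Y (contract_edge u v) G 1.
Proof.
move=> B t B0 Bt; pose F i := filled Y B i.
(* If [merged] lies in [B], then [val] already supplies [u], so [p] has to be [v]. Otherwise [p] is
   determined by the force that fills [merged], and the hypotheses on [i] single out the step of
   that force. *)
have [p [puv pB pq]] : exists p, [/\ p \in [set u; v],
    (merged \in B -> p = v) &
    forall i, merged \in F i.+1 -> merged \notin F i ->
      exists x q, [/\ [set p; q] = [set u; v],
        forces Y i (F i) (contract_map x) merged & adj x q]].
  have [mB|mB] := boolP (merged \in B).
    exists v; split; rewrite ?set22 // => i _ /negP[].
    exact: (subsetP (filled_mono Y B (leq0n i))).
  have mt : merged \in F t by rewrite /F Bt in_setT.
  have [k [X [mk Xm kP]]] := filled_first mt mB.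
  have [_ /contract_adjP[_ [x [q [xX qm xq]]]] _] := Xm.
  have quv : q \in [set u; v] by rewrite -contract_mergedP qm.
  have [p pqE] : exists p, [set p; q] = [set u; v].
    move: quv; rewrite !inE => /orP[]/eqP->; [exists v|exists u] => //.
    exact: setUC.
  exists p; split=> //; first by rewrite -pqE set21.
  move=> i; rewrite /F !kP ltnS -leqNgt => ki ik.
  have <- : k = i by apply/eqP; rewrite eqn_leq ki ik.
  by exists x, q; split; rewrite ?xX.
pose S i : {set G} := p |: [set a | contract_map a \in F i].
have SE i w : (w \in S i) = (w == p) || (contract_map w \in F i).
  by rewrite in_setU1 inE.
have subS i y : y \notin S i -> y != p /\ contract_map y \notin F i.
  by rewrite SE negb_or => /andP[].
have rivalsS i y w : y \notin S i ->
    rivals Y i (S i) y w -> rivals Y i (F i) (contract_map y) (contract_map w).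
  move=> yS; apply: rivals_map => a b /subS[_ aF] /subS[_ bF].
  case/contract_adj => [->|ab]; first exact: connect0.
  by apply: connect1; rewrite /unfilled_adj aF bF.
exists (p |: [set val A | A in B]); split.
- by apply/card_gt0P; exists p; rewrite setU11.
- rewrite addn1 cardsU1 card_imset; last exact: val_inj.
  by case: (_ \notin _).
apply: (@filled_all Y G _ S) => [w||i w wS1 wS].
- by rewrite SE /F Bt in_setT orbT.
- apply/subsetP => w; rewrite SE in_setU1 => /predU1P[->|wB].
    by rewrite eqxx.
  have [wv|wv] := eqVneq w v.
    rewrite wv pB ?eqxx //; rewrite wv in wB.
    have /eqP <- // : contract_map v == merged.
    by rewrite contract_mergedP set22.
  apply/orP; right; apply/imsetP; exists (contract_map w) => //.
  by rewrite contract_mapE /Defs.merge (negbTE wv).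
have [wp wF] := subS _ _ wS.
move: wS1; rewrite SE (negbTE wp) /= => wF1.
have [wm|wm] := eqVneq (contract_map w) merged.
  rewrite wm in wF1 wF; have [x [q [pqE [xF xm xP] xq]]] := pq _ wF1 wF.
  have wq : w = q.
    have : w \in [set p; q] by rewrite pqE -contract_mergedP wm.
    by rewrite !inE (negbTE wp) => /eqP.
  subst w; exists x; split=> //; first by rewrite SE xF orbT.
  move=> y yS xy yq; have [yp yF] := subS _ _ yS.
  have ym : contract_map y = merged.
    apply: xP => //; last by rewrite -wm; apply: rivalsS.
    case: (contract_adj xy) => [xyE|//].
    by rewrite -xyE xF in yF.
  have : y \in [set p; q] by rewrite pqE -contract_mergedP ym.
  by rewrite !inE (negbTE yp) => /eqP.
have [wF'|[X [XF Xw XP]]] := (filledSP Y B i _).1 wF1.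
  by rewrite /F wF' in wF.
case/contract_adjP: Xw => _ [x [b [xX bw xb]]].
have bwE : b = w by apply: contract_map_inj; rewrite ?bw.
subst b X; exists x; split=> //; first by rewrite SE XF orbT.
move=> y yS xy yw; have [yp yF] := subS _ _ yS.
have ywE : contract_map y = contract_map w.
  apply: XP => //; last exact: rivalsS.
  case: (contract_adj xy) => [xyE|//].
  by rewrite -xyE XF in yF.
by apply: contract_map_inj; rewrite ?ywE.
Qed.

(* With the merged vertex in the initial set its neighbors are all filled in
   the domination step, so neither [u] nor [v] is needed as a forcer later. *)
Lemma transfer_contract :
  transfers PowerDomination G (contract_edge u v) 1.
Proof.
move=> B t B0 Bt; pose F i := filled PowerDomination B i.
pose S i : {set contract_edge u v} :=
  [set w | [|| w == merged, w \in [set contract_map a | a in F i] |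
            (i != 0) && adj merged w]].
have SE i w : (w \in S i) = [|| w == merged,
    w \in [set contract_map a | a in F i] | (i != 0) && adj merged w].
  by rewrite inE.
have FS i a : a \in F i -> contract_map a \in S i.
  by move=> aF; rewrite SE imset_f ?orbT.
exists (S 0); split.
- by apply/card_gt0P; exists merged; rewrite SE eqxx.
- have -> : S 0 = merged |: [set contract_map a | a in B].
    by apply/setP => w; rewrite SE in_setU1 /= orbF.
  rewrite addn1 cardsU1.
  by rewrite (leq_trans (leq_add (leq_b1 _) (leq_imset_card _ _))).
apply: (@filled_all _ _ (S 0) S) => // [w|i w].
  by rewrite -[w]contract_mapK; apply: FS; rewrite /F Bt in_setT.
rewrite SE /= => wS1 wS; have wm : w != merged.
  by move: wS; rewrite SE negb_or => /andP[].
(* A neighbor of [merged] lies outside [S i] only for [i = 0], when nothing is a rival. *)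
have nbr : adj merged w ->
    exists x, forces PowerDomination i (S i) x w.
  move=> mw; case: i {wS1} wS => [_|i]; last by rewrite SE mw /= !orbT.
  by exists merged; split; rewrite // SE eqxx.
case/or3P: wS1 => [|/imsetP[a aF1 wE]|//]; first by rewrite (negbTE wm).
subst w; have [/FS|[x [xF xa xP]]] := (filledSP _ B i _).1 aF1.
  by rewrite (negbTE wS).
have [xm|xm] := eqVneq (contract_map x) merged.
  apply: nbr; rewrite -xm; case: (contract_adj xa) => [xaE|//].
  by rewrite -xaE xm eqxx in wm.
exists (contract_map x); split; first exact: FS.
  case: (contract_adj xa) => [xaE|//].
  by rewrite -xaE FS in wS.
move=> y yS /contract_adjP[_ [x' [b [x'x bE xb]]]] r; subst y.
have xE : x = x' by apply: contract_map_inj.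
subst x'; congr contract_map; apply: xP => //.
by apply: contra yS => /FS.
Qed.

End Contract.

(** * Subdivision *)

Section Subdivide.
Variables (G : sgraph) (u v : G) (e : adj u v).

Let Ge := subdivide_edge u v.

Lemma subdivide_adj (a b : G) : adj a b ->
  adj (Some a : Ge) (Some b) \/ [set a; b] = [set u; v].
Proof.
by move=> ab /=; rewrite /dele_rel ab /=; case: eqP; [right|left].
Qed.

Lemma subdivide_adjW (a b : G) : adj (Some a : Ge) (Some b) -> adj a b.
Proof. by case/andP. Qed.

Lemma subdivide_adj_end (p q : G) :
  [set p; q] = [set u; v] -> adj p q /\ ~~ adj (Some p : Ge) (Some q).
Proof.
move=> pq; split; last by rewrite /= /dele_rel pq eqxx andbF.
by case: (eq_set2 pq) => -[-> ->]; rewrite // adj_sym.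
Qed.

Lemma subdivide_adj_new (a : G) : adj (Some a : Ge) None = (a \in [set u; v]).
Proof. by []. Qed.

Lemma subdivide_adj_newl (a : G) :
  adj (None : Ge) (Some a) = (a \in [set u; v]).
Proof. by []. Qed.

(* A new vertex in [B] is replaced by the later-filled endpoint [q] of [e]. *)
Lemma filled_None_preim Y (B : {set Ge}) t (p q : G) :
  filled Y B t = [set: Ge] -> None \in B -> [set p; q] = [set u; v] ->
  (forall i, Some q \in filled Y B i -> Some p \in filled Y B i) ->
  filled Y (q |: [set a | Some a \in B]) t = [set: G].
Proof.
move=> Bt zB pq qp; pose F i := filled Y B i.
have zF i : None \in F i by apply: (subsetP (filled_mono Y B (leq0n i))).
pose S i : {set G} := q |: [set a | Some a \in F i].
have SE i w : (w \in S i) = (w == q) || (Some w \in F i).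
  by rewrite in_setU1 inE.
have subS i y : y \notin S i -> y != q /\ Some y \notin F i.
  by rewrite SE negb_or => /andP[].
have edgeS i a b : a \notin S i -> b \notin S i -> adj a b ->
    adj (Some a : Ge) (Some b).
  move=> /subS[aq _] /subS[bq _] /subdivide_adj[//|].
  rewrite -pq => /eq_set2[[_ bE]|[aE _]].
    by rewrite bE eqxx in bq.
  by rewrite aE eqxx in aq.
have rivalsS i y w :
    rivals Y i (S i) y w -> rivals Y i (F i) (Some y : Ge) (Some w).
  apply: (@rivals_map Y i G Ge Some) => a b aS bS ab; apply: connect1.
  have [[_ aF] [_ bF]] := (subS _ _ aS, subS _ _ bS).
  by rewrite /unfilled_adj aF bF; apply: edgeS aS bS ab.
apply: (@filled_all Y G (S 0) S) => // [w|i w wS1 wS].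
  by rewrite SE /F Bt in_setT orbT.
have [wq wF] := subS _ _ wS.
move: wS1; rewrite SE (negbTE wq) => wF1.
have [wF'|[[x|] [xF xw xP]]] := (filledSP Y B i _).1 wF1.
- by rewrite /F wF' in wF.
- exists x; split; [by rewrite SE xF orbT|exact: subdivide_adjW xw|].
  move=> y yS xy yw; have [yq yF] := subS _ _ yS.
  suff [] : Some y = Some w :> Ge by [].
  apply: xP => //; last exact: rivalsS.
  case: (subdivide_adj xy) => [//|]; rewrite -pq => /eq_set2[[_ yE]|[xE yE]].
    by rewrite yE eqxx in yq.
  by subst x y; rewrite /F qp in yF.
have wp : w = p.
  by move: xw; rewrite subdivide_adj_newl -pq !inE (negbTE wq) orbF => /eqP.
subst w; have [pq_adj _] := subdivide_adj_end pq.
(* The new vertex forces [p], so [q] is not a rival of [p]; hence no other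
   unfilled neighbor of [q] is. *)
exists q; split; [by rewrite SE eqxx|by rewrite adj_sym|].
move=> y yS qy yp; have [yq yF] := subS _ _ yS.
have [qyE|] := subdivide_adj qy; last first.
  by rewrite -pq => /eq_set2[[_ yE]|[_ //]]; rewrite yE eqxx in yq.
have [qF|qF] := boolP (Some q \in F i); first by rewrite /F qp in wF.
suff [qpE] : Some q = Some p :> Ge by rewrite qpE eqxx in wq.
apply: xP => //; first by rewrite subdivide_adj_newl -pq set22.
by apply: rivals_adjl (rivalsS _ _ _ yp); rewrite // adj_sym.
Qed.

(* If [p] forces the new vertex, then [p] forces the other endpoint of [e] in
   the same step in the original graph. *)
Lemma filled_notNone_preim Y (B : {set Ge}) t :
  filled Y B t = [set: Ge] -> None \notin B ->
  filled Y [set a | Some a \in B] t = [set: G].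
Proof.
move=> Bt zB; pose F i := filled Y B i.
have zt : None \in F t by rewrite /F Bt in_setT.
have [k [[p|] [zk [pF pz pP] kP]]] := filled_first zt zB => //.
have [q pq] : exists q, [set p; q] = [set u; v].
  move: pz; rewrite subdivide_adj_new !inE => /orP[]/eqP->.
    by exists v.
  by exists u; apply: setUC.
(* [q] enters at time [k.+1], when the new vertex is filled. *)
pose S i : {set G} := [set a | (Some a \in F i) || (k < i) && (a == q)].
have SE i w : (w \in S i) = (Some w \in F i) || (k < i) && (w == q).
  by rewrite inE.
have subS i y : y \notin S i -> Some y \notin F i.
  by rewrite SE negb_or => /andP[].
have edgeS i a b : k < i -> adj a b -> b \notin S i ->
    adj (Some a : Ge) (Some b).
  move=> ki /subdivide_adj[//|] + bS.
  rewrite -pq => /eq_set2[[_ bE]|[_ bE]]; move: bS.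
    by rewrite bE SE ki eqxx orbT.
  by rewrite bE SE /F (subsetP (filled_mono Y B (ltnW ki))).
have rivalsS i y w :
    rivals Y i (S i) y w -> rivals Y i (F i) (Some y : Ge) (Some w).
  apply: (@rivals_map Y i G Ge Some) => a b aS bS ab.
  have [aF bF] := (subS _ _ aS, subS _ _ bS).
  have [ki|ik] := ltnP k i.
    by apply: connect1; rewrite /unfilled_adj aF bF; apply: edgeS ki ab bS.
  have zF : None \notin F i by rewrite /F kP -leqNgt.
  (* While the new vertex is unfilled, the path through it replaces [e]. *)
  have [abE|abE] := subdivide_adj ab.
    by apply: connect1; rewrite /unfilled_adj aF bF.
  apply: (@connect_trans _ _ (None : Ge)); apply: connect1.
    by rewrite /unfilled_adj aF zF subdivide_adj_new -abE set21.
  by rewrite /unfilled_adj bF zF subdivide_adj_newl -abE set22.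
apply: (@filled_all Y G [set a | Some a \in B] S) => [w||i w wS1 wS].
- by rewrite SE /F Bt in_setT.
- by apply/subsetP => w; rewrite SE !inE orbF.
have wF := subS _ _ wS.
have step : Some w \in F i.+1 -> exists x, forces Y i (S i) x w.
  move=> wF1; have [wF'|[[x|] [xF xw xP]]] := (filledSP Y B i _).1 wF1.
  - by rewrite /F wF' in wF.
  - exists x; split; [by rewrite SE xF|exact: subdivide_adjW xw|].
    move=> y yS xy yw; have yF := subS _ _ yS.
    have [ki|ik] := ltnP k i.
      suff [] : Some y = Some w :> Ge by [].
      by apply: xP (rivalsS _ _ _ yw); last exact: edgeS ki xy yS.
    have zF : None \notin F i by rewrite /F kP -leqNgt.
    have [xyE|xyE] := subdivide_adj xy.
      suff [] : Some y = Some w :> Ge by [].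
      by apply: xP (rivalsS _ _ _ yw).
    (* Here [xy] is [e], so the new vertex is an unfilled neighbor of [x] and, through [y], a rival
       of [w]; this contradicts the force on [w]. *)
    have : None = Some w :> Ge; last by [].
    apply: xP => //; first by rewrite subdivide_adj_new -xyE set21.
    apply: rivals_adjl (rivalsS _ _ _ yw) => //.
    by rewrite subdivide_adj_new -xyE set22.
  (* If the new vertex is the forcer, then [k < i], and both ends of [e] already lie in [S i]. *)
  - case/negP: wS; rewrite SE.
    move: xw xF; rewrite subdivide_adj_newl -pq /F kP.
    rewrite !inE => /orP[]/eqP-> ki; last by rewrite ki eqxx orbT.
    by rewrite (subsetP (filled_mono Y B (ltnW ki))).
move: wS1; rewrite SE => /orP[//|/andP[ki /eqP wq]]; subst w.
have ik : k = i.
  apply/eqP; rewrite eqn_leq -ltnS ki /= leqNgt; apply/negP => ki'.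
  by rewrite SE ki' eqxx orbT in wS.
subst k; have [pq_adj _] := subdivide_adj_end pq.
exists p; split=> //; first by rewrite SE pF.
move=> y yS py yq; have yF := subS _ _ yS.
have [pyE|pyE] := subdivide_adj py; last first.
  have : y \in [set p; q] by rewrite pq -pyE set22.
  rewrite !inE => /orP[/eqP yp|/eqP//].
  by rewrite yp pF in yF.
(* The unfilled vertex [q] is adjacent to the new vertex, so a rival of [q] is a rival of the new
   vertex, which [p] forces. *)
have : Some y = None :> Ge; last by [].
apply: pP => //; rewrite rivals_sym.
apply: rivals_adjl _ _ _ (_ : rivals Y i (F i) (Some q : Ge) _) => //.
  by rewrite subdivide_adj_new -pq set22.
by rewrite rivals_sym; apply: rivalsS.
Qed.

Lemma transfer_unsubdivide Y : transfers Y Ge G 0.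
Proof.
move=> B t B0 Bt.
have cardS : #|[set a | Some a \in B]| + (None \in B) = #|B|.
  have -> : #|[set a | Some a \in B]| = #|B :\ None|.
    rewrite -(card_imset [set a | Some a \in B] (@Some_inj _)).
    apply: eq_card => -[a|]; rewrite !inE.
      by rewrite mem_imset ?inE //; apply: Some_inj.
    by apply/imsetP => -[].
  by rewrite addnC -cardsD1.
have [zB|zB] := boolP (None \in B).
  have [a [b [ab aN bN qp]]] := filled_total Y B (Some u : Ge) (Some v).
  have [p [q [pq aE bE]]] : exists p q,
      [/\ [set p; q] = [set u; v], a = Some p & b = Some q].
    case: (eq_set2 ab) => -[-> ->]; [exists u, v|exists v, u]; split=> //.
    exact: setUC.
  subst a b; exists (q |: [set a | Some a \in B]); split.
  - by apply/card_gt0P; exists q; rewrite setU11.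
  - by rewrite addn0 -cardS zB addn1 cardsU1; case: (_ \notin _).
  - exact: filled_None_preim pq qp.
exists [set a | Some a \in B].
rewrite addn0 -cardS (negbTE zB) /= addn0 in B0 *.
split=> //.
exact: filled_notNone_preim.
Qed.

(** With the new vertex in the set, the domination step fills both ends of [e], so no later force
    along [e] is needed. *)
Lemma transfer_subdivide_PD : transfers PowerDomination G Ge 1.
Proof.
move=> B t B0 Bt; pose F i := filled PowerDomination B i.
pose S i : {set Ge} := [set w | if w is Some a
  then (a \in F i) || (i != 0) && (a \in [set u; v]) else true].
have SE i a : (Some a \in S i) = (a \in F i) || (i != 0) && (a \in [set u; v]).
  by rewrite inE.
have zS i : None \in S i by rewrite inE.
exists (S 0); split.
- by apply/card_gt0P; exists None.
- have -> : S 0 = None |: [set Some a | a in B].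
    apply/setP => -[a|]; rewrite !inE //= orbF mem_imset //; exact: Some_inj.
  by rewrite addn1 cardsU1 card_imset; [case: (_ \notin _)|exact: Some_inj].
apply: (@filled_all _ Ge (S 0) S) => // [[w|]|i [w|]]; rewrite ?zS //.
  by rewrite SE /F Bt in_setT.
rewrite !SE negb_or => wS1 /andP[wF wS].
have [wuv|wuv] := boolP (w \in [set u; v]).
  exists None; split=> // -[y|] yS // _.
  by move: wS; rewrite wuv andbT negbK => /eqP->.
move: wS1; rewrite (negbTE wuv) andbF orbF => wF1.
have [wF'|[x [xF xw xP]]] := (filledSP _ B i _).1 wF1.
  by rewrite /F wF' in wF.
exists (Some x); split; first by rewrite SE xF.
  case: (subdivide_adj xw) => // xwE.
  by rewrite -xwE set22 in wuv.
move=> [y|] yS; last by rewrite zS in yS.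
move=> /subdivide_adjW xy yw; congr Some; apply: xP => //.
by apply: contra yS => yF; rewrite SE yF.
Qed.

(** * Forces in a subdivided graph under the PSD rule *)

Section SubdividePSD.
Variables (p q : G) (pq : [set p; q] = [set u; v]).

Definition subset_old (C : {set G}) : {set Ge} := [set Some a | a in C].

Lemma in_subset_old C a : (Some a \in subset_old C) = (a \in C).
Proof. by apply: mem_imset; apply: Some_inj. Qed.

Lemma None_subset_old C : None \notin subset_old C.
Proof. by apply/imsetP => -[]. Qed.

(** [odflt q] contracts the new vertex into [q]. As both are unfilled, unfilled paths stay
    connected: the edge from [p] to the new vertex becomes [e]. *)
Lemma rivals_unsubdivide i (C : {set G}) (y w : Ge) : q \notin C ->
  rivals PSDForcing i (subset_old C) y w ->
  rivals PSDForcing i C (odflt q y) (odflt q w).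
Proof.
move=> qC; have [pq_adj _] := subdivide_adj_end pq.
have newE a : a \notin C -> a \in [set p; q] -> connect (unfilled_adj C) a q.
  rewrite !inE => aC /orP[]/eqP aE; rewrite aE ?connect0 //.
  by apply: connect1; rewrite /unfilled_adj -aE aC qC aE.
apply: (@rivals_map _ i Ge G (odflt q)) => -[a|] [b|] //=.
all: rewrite !in_subset_old.
- move=> aC bC /andP[ab _]; apply: connect1.
  by rewrite /unfilled_adj aC bC.
- by move=> aC _; rewrite -pq; apply: newE.
- by move=> _ bC; rewrite -pq unfilled_connect_sym; apply: newE.
Qed.

(** The only new obstacle is the new vertex as a neighbor of [x = p]; if it were a rival of [w],
    then [q] would be one in [G], and the force would be along [e]. *)
Lemma forces_subdivide i (C : {set G}) x w : q \notin C ->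
  [set x; w] <> [set p; q] -> forces PSDForcing i C x w ->
  forces PSDForcing i (subset_old C) (Some x : Ge) (Some w).
Proof.
move=> qC xwE [xC xw xP]; split; first by rewrite in_subset_old.
  by case: (subdivide_adj xw) => //; rewrite -pq => /xwE.
move=> [y|] yS xy /(rivals_unsubdivide qC) /= yw.
  congr Some; apply: xP => //; first by rewrite -in_subset_old.
  exact: subdivide_adjW xy.
have [pq_adj _] := subdivide_adj_end pq.
move: xy; rewrite subdivide_adj_new -pq !inE => /orP[]/eqP xE; subst x.
  by case: xwE; rewrite (xP q).
by rewrite xC in qC.
Qed.

(** Contracting the new vertex into [q] shows that another rival neighbor of [p] would be [q]
    itself, which is not adjacent to [p] after the subdivision. *)
Lemma forces_new i (C : {set G}) : q \notin C -> forces PSDForcing i C p q ->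
  forces PSDForcing i (subset_old C) (Some p : Ge) None.
Proof.
move=> qC [pC pq_adj pP]; split; first by rewrite in_subset_old.
  by rewrite subdivide_adj_new -pq set21.
move=> [y|//] yS py /(rivals_unsubdivide qC) /= yq.
have yE : y = q.
  apply: pP => //; first by rewrite -in_subset_old.
  exact: subdivide_adjW py.
by have [_ /negP[]] := subdivide_adj_end pq; rewrite -yE.
Qed.

(** With both of its neighbors filled, the new vertex is by itself a component of the unfilled
    graph. *)
Lemma forces_new_isolated i (C : {set G}) : p \in C -> q \in C ->
  forces PSDForcing i (subset_old C) (Some p : Ge) None.
Proof.
move=> pC qC; split; first by rewrite in_subset_old.
  by rewrite subdivide_adj_new -pq set21.
move=> y _ _; rewrite rivals_sym /= => /connectP[[|[b|] s] //= + ->] //;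
  case/andP=> /and3P[_] //; rewrite in_subset_old => bC bN _.
have : b \in [set u; v] by [].
by rewrite -pq !inE => /orP[]/eqP bE; rewrite bE ?pC ?qC in bC.
Qed.

(** The new vertex, whose other neighbor [p] is filled, can always force [q]; every other force
    survives unchanged. *)
Lemma forces_subdivide_new i (C : {set G}) x w : p \in C -> w \notin C ->
  forces PSDForcing i C x w ->
  exists x', forces PSDForcing i ((None : Ge) |: subset_old C) x' (Some w).
Proof.
move=> pC wC [xC xw xP].
have inC a : (Some a \in (None : Ge) |: subset_old C) = (a \in C).
  by rewrite in_setU1 in_subset_old.
have [wq|wq] := eqVneq w q.
  exists None; split; first by rewrite setU11.
    by rewrite subdivide_adj_newl -pq wq set22.
  move=> [y|]; last by rewrite setU11.
  rewrite inC subdivide_adj_newl -pq !inE wq => yC /orP[]/eqP yE _.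
    by rewrite yE pC in yC.
  by rewrite yE.
exists (Some x); split; first by rewrite inC.
  case: (subdivide_adj xw) => //; rewrite -pq => /eq_set2[[_ wE]|[_ wE]].
    by rewrite wE eqxx in wq.
  by rewrite wE pC in wC.
move=> [y|]; last by rewrite setU11.
rewrite inC => yC xy yw; congr Some; apply: xP => //.
  exact: subdivide_adjW xy.
(* The default [q] is only the value at the new vertex, which is filled. *)
apply: (@rivals_map _ i Ge G (odflt q)) yw => -[a|] [b|]; rewrite ?setU11 //.
rewrite !inC => aC bC /subdivide_adjW ab; apply: connect1.
by rewrite /unfilled_adj aC bC.
Qed.

End SubdividePSD.

(* Only a force along [e] is delayed: one endpoint first forces the new vertex,
   which then forces the other endpoint. *)
Lemma filled_subdivide_PSD (B : {set G}) t :
  filled PSDForcing B t = [set: G] ->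
  filled PSDForcing (subset_old B) t.+1 = [set: Ge].
Proof.
move=> Bt; have [p [q [pq _ _ qp]]] := filled_total PSDForcing B u v.
pose F i := filled PSDForcing B i.
pose F' i := filled PSDForcing (subset_old B) i.
have F'S i : F' i \subset F' i.+1 by apply: filled_mono.
(* While [q] is unfilled, it has neither forced nor been forced, so no force was along [e] and
   nothing is delayed. *)
have early i : q \notin F i -> subset_old (F i) \subset F' i.
  elim: i => [//|i IHi] qF1.
  have qF : q \notin F i.
    by apply: contra qF1; apply: (subsetP (filled_mono _ _ _)).
  apply/subsetP => -[w|]; last by rewrite (negbTE (None_subset_old _)).
  rewrite in_subset_old => wF1.
  have [wF|[x xw]] := (filledSP _ B i _).1 wF1; apply/filledSP.
    by left; apply: (subsetP (IHi qF)); rewrite in_subset_old.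
  right; exists (Some x); apply: forces_mono (IHi qF) _.
  apply: (forces_subdivide pq) => // /eq_set2[[_ wE]|[xE _]].
    by rewrite -wE wF1 in qF1.
  by case: xw; rewrite xE (negbTE qF).
(* From time [j] on, the subdivided process lags by one step. Take [j = 0] if [q], hence also [p],
   lies in [B]; [j = k] if [p] forces [q] in step [k.+1], this force being diverted to the new
   vertex; [j = k.+1] if another vertex forces [q], the new vertex following by the next step. *)
have [j [jt pj Fj]] : exists j,
    [/\ j <= t, p \in F j & (None : Ge) |: subset_old (F j) \subset F' j.+1].
  have [qB|qB] := boolP (q \in B).
    exists 0; split=> //; first exact: (qp 0).
    rewrite subUset sub1set; apply/andP; split; last exact: (F'S 0).
    apply/filledSP; right.
    by exists (Some p); apply: (forces_new_isolated pq) => //; apply: (qp 0).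
  have qt : q \in F t by rewrite /F Bt in_setT.
  have [k [x [qk xq kP]]] := filled_first qt qB.
  have kt : k < t by rewrite -kP.
  have [xp|xp] := eqVneq x p.
    subst x; exists k; split; [exact: ltnW|by case: xq|].
    rewrite subUset sub1set (subset_trans (early _ qk)) ?andbT //.
    apply/filledSP; right; exists (Some p).
    exact: forces_mono (early _ qk) (forces_new pq qk xq).
  have qk1 : q \in F k.+1 by rewrite /F kP.
  exists k.+1; split=> //; first exact: (qp k.+1).
  have Fk1 : subset_old (F k.+1) \subset F' k.+1.
    apply/subsetP => -[w|]; last by rewrite (negbTE (None_subset_old _)).
    rewrite in_subset_old => wF1; apply/filledSP.
    have [->|wq] := eqVneq w q.
      right; exists (Some x); apply: forces_mono (early _ qk) _.
      apply: (forces_subdivide pq) => // /eq_set2[[xE _]|[xE _]].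
        by rewrite xE eqxx in xp.
      by case: xq; rewrite xE (negbTE qk).
    have [wF|[y yw]] := (filledSP _ B k _).1 wF1.
      by left; apply: (subsetP (early _ qk)); rewrite in_subset_old.
    right; exists (Some y); apply: forces_mono (early _ qk) _.
    apply: (forces_subdivide pq) => // /eq_set2[[_ wE]|[yE _]].
      by rewrite wE eqxx in wq.
    by case: yw; rewrite yE (negbTE qk).
  rewrite subUset sub1set (subset_trans Fk1) ?andbT //.
  apply/filledSP; right; exists (Some p); apply: forces_mono Fk1 _.
  by apply: (forces_new_isolated pq) => //; apply: (qp k.+1).
have late i : (None : Ge) |: subset_old (F (j + i)) \subset F' (j + i).+1.
  elim: i => [|i IHi]; first by rewrite addn0.
  have pi : p \in F (j + i).
    by apply: (subsetP (filled_mono _ _ _)) pj; rewrite leq_addr.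
  rewrite addnS; apply/subsetP => -[w|] wS; last first.
    by apply: (subsetP (F'S _)); apply: (subsetP IHi); rewrite setU11.
  have wF1 : w \in F (j + i).+1 by move: wS; rewrite in_setU1 in_subset_old.
  apply/filledSP.
  have [wF|wF] := boolP (w \in F (j + i)).
    by left; apply: (subsetP IHi); rewrite in_setU1 in_subset_old wF orbT.
  have [wF'|[x xw]] := (filledSP _ B _ _).1 wF1; first by rewrite /F wF' in wF.
  have [x' x'w] := forces_subdivide_new pq pi wF xw.
  by right; exists x'; apply: forces_mono IHi x'w.
apply/eqP; rewrite -subTset.
have := late (t - j); rewrite subnKC //; apply: subset_trans.
apply/subsetP => -[w|] _; last by rewrite setU11.
by rewrite in_setU1 in_subset_old /F Bt in_setT.
Qed.

End Subdivide.

(** * Throttling numbers *)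

Local Open Scope ereal_scope.

Section ThrottlingNumbers.
Variables (Y : process) (G : sgraph).
Implicit Type B : {set G}.

Lemma pt_le B t : filled Y B t = [set: G] -> pt Y B <= t%:R%:E.
Proof.
move=> Bt; rewrite /pt; case: pselect => [ex_t|[]]; last by exists t; apply/eqP.
by case: ex_minnP => m _ mP; rewrite lee_fin ler_nat mP // Bt.
Qed.

Lemma ptP B :
  pt Y B = +oo \/ exists2 t, filled Y B t = [set: G] & pt Y B = t%:R%:E.
Proof.
rewrite /pt; case: pselect => [ex_t|_]; last by left.
by right; case: ex_minnP => t /eqP Bt _; exists t.
Qed.

Lemma th_times_le B t : (0 < #|B|)%N -> filled Y B t = [set: G] ->
  th_times G Y <= (#|B| * t.+1)%:R%:E.
Proof.
move=> B0 Bt; rewrite /th_times.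
apply: le_trans (_ : #|B|%:R%:E * (1 + pt Y B) <= _).
  apply: (@bigmin_inf_seq _ _ _ _ _ #|B|) => //.
    by rewrite mem_index_iota B0 ltnS max_card.
  exact: bigmin_le_cond.
rewrite natrM EFinM lee_wpmul2l ?lee_fin ?ler0n //.
by rewrite -nat1r EFinD leeD2l // pt_le.
Qed.

Lemma th_star_le B t : (0 < #|B|)%N -> (#|B| < #|G|)%N ->
  filled Y B t = [set: G] -> th_star G Y <= (#|B| * t)%:R%:E.
Proof.
move=> B0 BG Bt; rewrite /th_star.
apply: le_trans (_ : #|B|%:R%:E * pt Y B <= _).
  apply: (@bigmin_inf_seq _ _ _ _ _ #|B|) => //.
    by rewrite mem_index_iota B0.
  exact: bigmin_le_cond.
by rewrite natrM EFinM lee_wpmul2l ?lee_fin ?ler0n // pt_le.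
Qed.

Lemma big_mine_cases (n : nat) (F : {set G} -> \bar rat) :
  let m := \big[mine/+oo]_(1 <= k < n)
             \big[mine/+oo]_(B : {set G} | #|B| == k) F B in
  m = +oo \/ exists B, [/\ (0 < #|B|)%N, (#|B| < n)%N & m = F B].
Proof.
pose P m := m = +oo \/ exists B, [/\ (0 < #|B|)%N, (#|B| < n)%N & m = F B].
have Pmin a b : P a -> P b -> P (mine a b) by rewrite /mine; case: ifP.
rewrite big_nat_cond; apply: (big_ind P) => [|//|k /andP[/andP[k0 kn] _]].
  by left.
apply: (big_ind P) => [|//|B /eqP Bk]; first by left.
by right; exists B; rewrite Bk.
Qed.

Lemma th_timesP : th_times G Y = +oo \/
  exists B t, [/\ (0 < #|B|)%N, filled Y B t = [set: G] &
                  th_times G Y = (#|B| * t.+1)%:R%:E].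
Proof.
case: (big_mine_cases #|G|.+1 (fun B => #|B|%:R%:E * (1 + pt Y B))).
  by left.
case=> B [B0 _ thE]; case: (ptP B) => [ptE|[t Bt ptE]]; [left|right].
  by rewrite /th_times thE ptE addey // gt0_muley // lte_fin ltr0n.
exists B, t; split=> //; rewrite /th_times thE ptE.
by rewrite -EFinD -EFinM natrM -natr1 addrC.
Qed.

Lemma th_starP : th_star G Y = +oo \/
  exists B t, [/\ (0 < #|B|)%N, (0 < t)%N, (#|B| < #|G|)%N,
    filled Y B t = [set: G] & th_star G Y = (#|B| * t)%:R%:E].
Proof.
case: (big_mine_cases #|G| (fun B => #|B|%:R%:E * pt Y B)).
  by left.
case=> B [B0 BG thE]; case: (ptP B) => [ptE|[t Bt ptE]]; [left|right].
  by rewrite /th_star thE ptE gt0_muley // lte_fin ltr0n.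
exists B, t; split=> //; last by rewrite /th_star thE ptE -EFinM natrM.
(* A proper subset is not full at time [0], whence [0 < t]. *)
by case: t Bt {ptE} => // BT; rewrite (BT : B = _) cardsT ltnn in BG.
Qed.

Lemma th_star_le_pred : has_edge G -> th_star G Y <= (#|G|.-1)%:R%:E.
Proof.
case=> a [b ab]; have ba : a != b.
  by apply/eqP => abE; rewrite abE adj_irrefl in ab.
have cardB : #|[set~ b]| = #|G|.-1 by rewrite cardsC1.
have aB : a \in [set~ b] by rewrite !inE.
rewrite -[#|G|.-1]muln1 -cardB; apply: th_star_le.
- by apply/card_gt0P; exists a.
- by rewrite cardB prednK //; apply/card_gt0P; exists a.
apply/setP => w; rewrite in_setT; apply/filledSP => /=.
have [->|wb] := eqVneq w b; last by left; rewrite !inE.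
by right; exists a; split=> // y; rewrite !inE negbK => /eqP->.
Qed.

End ThrottlingNumbers.

(** * From transfers to inequalities between throttling numbers *)

Section Transfer.
Variables (Y : process) (G H : sgraph) (d : nat).
Hypothesis GH : transfers Y G H d.

Lemma th_times_transfer : th_times H Y <= d.+1%:R%:E * th_times G Y.
Proof.
have [->|[B [t [B0 Bt ->]]]] := th_timesP Y G.
  by rewrite gt0_muley ?leey // lte_fin ltr0n.
have [B' [B'0 B'd B't]] := GH B0 Bt; apply: le_trans (th_times_le B'0 B't) _.
rewrite -EFinM -natrM lee_fin ler_nat mulnA leq_mul2r; apply/orP; right.
by rewrite (leq_trans B'd) // mulSn leq_add2l leq_pmulr.
Qed.

Lemma th_star_transfer : has_edge H -> th_star H Y <= d.+1%:R%:E * th_star G Y.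
Proof.
move=> eH; have [->|[B [t [B0 t0 BG Bt ->]]]] := th_starP Y G.
  by rewrite gt0_muley ?leey // lte_fin ltr0n.
have [B' [B'0 B'd B't]] := GH B0 Bt.
have B'B : (#|B'| <= d.+1 * #|B|)%N.
  by rewrite (leq_trans B'd) // mulSn leq_add2l leq_pmulr.
rewrite -EFinM -natrM mulnA; have [B'H|HB'] := ltnP #|B'| #|H|.
  apply: le_trans (th_star_le B'0 B'H B't) _.
  by rewrite lee_fin ler_nat leq_mul2r B'B orbT.
(* Here [B'] is not admissible: [#|H|.-1 <= #|B'| <= d.+1 * #|B|], and [0 < t] allows the factor [t]
   on the right. *)
apply: le_trans (th_star_le_pred Y eH) _; rewrite lee_fin ler_nat.
rewrite (leq_trans (leq_pred _)) // (leq_trans HB') // (leq_trans B'B) //.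
by rewrite leq_pmulr.
Qed.

End Transfer.

Lemma half_le (a b : \bar rat) : a <= 2%:R%:E * b -> (1 / 2)%R%:E * a <= b.
Proof. by move=> ab; rewrite div1r lee_pdivrMl. Qed.

Section SubdivisionPSD.
Variables (G : sgraph) (u v : G) (e : adj u v).

Lemma card_subset_old (C : {set G}) : #|subset_old u v C| = #|C|.
Proof. by apply: card_imset; apply: Some_inj. Qed.

(** The price is one more time step and not one more vertex; [0 < t] gives [t + 1 <= 2 * t]. *)
Lemma th_star_subdivide_PSD :
  th_star (subdivide_edge u v) PSDForcing <= 2%:R%:E * th_star G PSDForcing.
Proof.
have [->|[B [t [B0 t0 BG Bt ->]]]] := th_starP PSDForcing G.
  by rewrite gt0_muley ?leey // lte_fin ltr0n.
apply: le_trans (th_star_le _ _ (filled_subdivide_PSD e Bt)) _.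
- by rewrite card_subset_old.
- by rewrite card_subset_old card_option ltnS ltnW.
rewrite card_subset_old -EFinM -natrM lee_fin ler_nat mulnCA leq_mul2l.
by rewrite mul2n -addnn -addn1 leq_add2l t0 orbT.
Qed.

Lemma th_times_subdivide_PSD :
  th_times (subdivide_edge u v) PSDForcing
    <= (3 / 2)%R%:E * th_times G PSDForcing.
Proof.
have [->|[B [t [B0 Bt ->]]]] := th_timesP PSDForcing G.
  by rewrite gt0_muley ?leey ?lte_fin ?divr_gt0 ?ltr0n.
have half n m : (2 * n <= 3 * m)%N ->
    n%:R%:E <= (3 / 2)%R%:E * m%:R%:E :> \bar rat.
  move=> nm; rewrite -EFinM lee_fin mulrAC ler_pdivlMr // mulrC -!natrM ler_nat.
  exact: nm.
case: t Bt => [|t] Bt.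
  have BT : #|B| = #|G| by rewrite (Bt : B = _) cardsT.
  pose B' := [set: subdivide_edge u v].
  apply: le_trans (th_times_le (B := B') (t := 0) _ _) _ => //.
    by rewrite cardsT card_option.
  rewrite cardsT card_option !muln1 BT; apply: half.
  (* Taking all vertices of the subdivision costs [#|G| + 1], which is at most [3/2 * #|G|] once
     [2 <= #|G|]; the two ends of [e] ensure this. *)
  have : (1 < #|G|)%N.
    have uv : u != v by apply/eqP => uv; move: e; rewrite uv adj_irrefl.
    by rewrite -cardsT (cardsD1 u) (cardsD1 v) !inE eq_sym uv.
  by rewrite mulnS (mulSn 2) leq_add2r.
apply: le_trans (th_times_le _ (filled_subdivide_PSD e Bt)) _.
  by rewrite card_subset_old.
rewrite card_subset_old; apply: half.
rewrite !(mulnCA _ #|B|) leq_mul2l; apply/orP; right.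
by rewrite mulnS (mulSn 2) leq_add2r.
Qed.

End SubdivisionPSD.

Theorem proposition3p2 (G : sgraph) (x u v : G) (e : adj u v) :
  (forall Y : process,
    (has_edge (delete_edge u v) ->
       (1 / 2)%R%:E * th_star G Y <= th_star (delete_edge u v) Y /\
       th_star (delete_edge u v) Y <= 2%:E * th_star G Y) /\
    (1 / 2)%R%:E * th_times G Y <= th_times (delete_edge u v) Y /\
    th_times (delete_edge u v) Y <= 2%:E * th_times G Y)
  /\
  (forall Y : process,
    (has_edge (delete_vertex x) ->
       (1 / 2)%R%:E * th_star G Y <= th_star (delete_vertex x) Y) /\
    (1 / 2)%R%:E * th_times G Y <= th_times (delete_vertex x) Y)
  /\
  ((has_edge (contract_edge u v) ->
      (1 / 2)%R%:E * th_star G PowerDomination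
        <= th_star (contract_edge u v) PowerDomination /\
      th_star (contract_edge u v) PowerDomination
        <= 2%:E * th_star G PowerDomination) /\
   (1 / 2)%R%:E * th_times G PowerDomination
     <= th_times (contract_edge u v) PowerDomination /\
   th_times (contract_edge u v) PowerDomination
     <= 2%:E * th_times G PowerDomination)
  /\
  ((has_edge (contract_edge u v) ->
      (1 / 2)%R%:E * th_star G PSDForcing
        <= th_star (contract_edge u v) PSDForcing) /\
   (1 / 2)%R%:E * th_times G PSDForcing
     <= th_times (contract_edge u v) PSDForcing)
  /\
  (forall Y : process,
    th_star G Y <= th_star (subdivide_edge u v) Y /\
    th_star (subdivide_edge u v) Y <= 2%:E * th_star G Y)
  /\
  (th_times G PowerDomination
     <= th_times (subdivide_edge u v) PowerDomination /\
   th_times (subdivide_edge u v) PowerDomination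
     <= 2%:E * th_times G PowerDomination /\
   th_times G PSDForcing <= th_times (subdivide_edge u v) PSDForcing /\
   th_times (subdivide_edge u v) PSDForcing
     <= (3 / 2)%R%:E * th_times G PSDForcing).
Proof.
have eG : has_edge G by exists u, v.
have eGe : has_edge (subdivide_edge u v).
  by exists (Some u), None; rewrite subdivide_adj_new set21.
have unsub Y : transfers Y (subdivide_edge u v) G 0.
  exact: transfer_unsubdivide.
have unsub_times Y : th_times G Y <= th_times (subdivide_edge u v) Y.
  by have := th_times_transfer (unsub Y); rewrite mul1e.
split; [|split; [|split; [|split; [|split]]]].
- move=> Y; split=> [ed|]; split.
  + exact/half_le/th_star_transfer/eG/transfer_undelete_edge.
  + exact/th_star_transfer/ed/transfer_delete_edge.
  + exact/half_le/th_times_transfer/transfer_undelete_edge.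
  + exact/th_times_transfer/transfer_delete_edge.
- move=> Y; split=> [_|].
  + exact/half_le/th_star_transfer/eG/transfer_delete_vertex.
  + exact/half_le/th_times_transfer/transfer_delete_vertex.
- split=> [ec|]; split.
  + exact/half_le/th_star_transfer/eG/transfer_uncontract.
  + exact/th_star_transfer/ec/transfer_contract.
  + exact/half_le/th_times_transfer/transfer_uncontract.
  + exact/th_times_transfer/transfer_contract.
- split=> [_|].
  + exact/half_le/th_star_transfer/eG/transfer_uncontract.
  + exact/half_le/th_times_transfer/transfer_uncontract.
- move=> Y; split.
  + by have := th_star_transfer (unsub Y) eG; rewrite mul1e.
  + case: Y; last exact: th_star_subdivide_PSD.
    exact/th_star_transfer/eGe/transfer_subdivide_PD.
- split=> //; split; last by split=> //; exact: th_times_subdivide_PSD.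
  exact/th_times_transfer/transfer_subdivide_PD.
Qed.
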